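(* For all positive integers $n$ and non-negative integers $k$, $$\det_{0\le i,j\le n-1}\Big(\sum_{l\ge0}\mathcal P^+_{i+j}(k,l)\Big)= \begin{cases} (-1)^{n_1\binom{k+1}2}(xy)^{(k+1)^2\binom{n_1+1}2-n}, & \text{if } n=(k+1)n_1,\\ (-1)^{n_1\binom{k+1}2}(xy)^{(k+1)^2\binom{n_1+1}2}, & \text{if } n=(k+1)n_1+1,\\ 0, & \text{if } n\not\equiv 0,1 \pmod{k+1}. \end{cases}$$ Here $n_1$ denotes a non-negative integer. For $k=0$ (where the first two cases overlap) only the first case applies, i.e. the determinant equals $(xy)^{\binom n2}$.
   Context: Three-step paths consist of up-steps $(1,1)$, level steps $(1,0)$ and down-steps $(1,-1)$. Weights: $w((1,1))=1$, $w((1,0))=x+y$, $w((1,-1))=xy$, and the weight $w(P)$ of a path is the product of the weights of its steps. $\mathcal P_n(k,l)=\sum_P w(P)$ over all three-step paths from $(0,k)$ to $(n,l)$; $\mathcal P^+_n(k,l)$ is the same sum restricted to paths that never run below the $x$-axis. For fixed $n,k$ the sum $\sum_{l\ge0}\mathcal P^+_n(k,l)$ is finite. These are polynomials in the indeterminates $x,y$. *)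

(* Defs.v *)
(* Polynomial identities in Z[x,y] are stated for arbitrary
   elements x y of an arbitrary commutative ring R (equivalent, by universality). *)
From HB Require Import structures.
From mathcomp Require Import all_boot all_order all_algebra.
Set Implicit Arguments. Unset Strict Implicit. Unset Printing Implicit Defensive.
Import Order.TTheory GRing.Theory Num.Theory.
Local Open Scope ring_scope.

(* A step is encoded by s : 'I_3 : 0 = down (1,-1), 1 = level (1,0), 2 = up (1,1). *)
Definition step_dy (s : 'I_3) : int := (nat_of_ord s)%:Z - 1.

Definition step_w (R : comNzRingType) (x y : R) (s : 'I_3) : R :=
  match nat_of_ord s with
  | 0%N => x * y
  | 1%N => x + y
  | _ => 1
  end.

Definition height (n : nat) (k : nat) (p : n.-tuple 'I_3) (i : nat) : int :=
  k%:Z + \sum_(j < n | (j < i)%N) step_dy (tnth p j).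

Definition path_w (R : comNzRingType) (x y : R) (n : nat) (p : n.-tuple 'I_3) : R :=
  \prod_(j < n) step_w x y (tnth p j).

Definition Pplus (R : comNzRingType) (x y : R) (n k l : nat) : R :=
  \sum_(p : n.-tuple 'I_3 |
          (height k p n == l%:Z) && [forall i : 'I_n.+1, 0 <= height k p i])
     path_w x y p.

(* sum_{l >= 0} P^+_n(k,l); terms with l > n + k vanish (no such path). *)
Definition Pplus_sum (R : comNzRingType) (x y : R) (n k : nat) : R :=
  \sum_(l < (n + k).+1) Pplus x y n k l.

(* Main.v *)
(** Put [c = x + y], [p = x y] and let [L_k] be the linear functional on
polynomials sending [X^n] to the total weight of the paths of length [n] that
start at height [k] and stay nonnegative. The determinant is the Gram
determinant of [L_k (f g)] in any basis of monic polynomials. With [U_m] the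
Chebyshev-like polynomials [U_0 = 0], [U_1 = 1],
[U_(m+2) = (X - c) U_(m+1) - p U_m], one has [L_k f = L_0 (U_(k+1) f)] and
[L_0 U_(m+1) = 1]; hence, for [z = X - c - 1 - p], [L_0 (z U_(m+1) f)] vanishes
when [deg f < m]. Let [Q = k + 1] and [V_a = U_(Q a) / U_Q]. In the basis
made of [V_(b+1) - V_b] (degree [Q b]) and [z V_(b+1) U_(s+1)] with [s < k]
(degree [Q b + s + 1]), the Gram matrix is block diagonal, with blocks of size
[1] equal to [p^(Q b)] alternating with antitriangular blocks of size [k] whose
antidiagonal entries are all [- p^(Q (b+1))]. *)

Require Import Defs.
From HB Require Import structures.
From mathcomp Require Import all_boot all_order all_algebra.
From mathcomp Require Import zify ring.
Import Order.TTheory GRing.Theory Num.Theory.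
Local Open Scope ring_scope.
Set Implicit Arguments.
Unset Strict Implicit.
Unset Printing Implicit Defensive.

(** * Block-triangular and antitriangular determinants *)

Section Determinants.
Variable R : comNzRingType.
Implicit Types (A : nat -> nat -> R) (d : R).

Definition detn A n := \det (\matrix_(i < n, j < n) A i j).

Lemma detn_lower_block A m l :
  (forall i j, (i < m)%N -> (m <= j)%N -> A i j = 0) ->
  detn A (m + l) = detn A m * detn (fun i j => A (m + i)%N (m + j)%N) l.
Proof.
move=> A0; rewrite /detn -[X in \det X]submxK.
have -> : ursubmx (\matrix_(i < m + l, j < m + l) A i j) = 0.
  by apply/matrixP=> i j; rewrite !mxE A0 //= leq_addr.
rewrite det_lblock; by congr (_ * _); congr determinant; apply/matrixP=> i j; rewrite !mxE.
Qed.

(** Only the last entry of the first row survives expansion. At size [n.+1] it carries the sign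
    [(-1) ^+ n], and ['C(n.+1, 2) = 'C(n, 2) + n]. *)
Lemma detn_antitriangular A d n :
  (forall i j, (i + j + 1 < n)%N -> A i j = 0) ->
  (forall i j, (i + j + 1 = n)%N -> A i j = d) ->
  detn A n = (-1) ^+ 'C(n, 2) * d ^+ n.
Proof.
elim: n A => [|n IHn] A A0 Ad; first by rewrite /detn det_mx00 mul1r.
rewrite /detn (expand_det_row _ ord0) (bigD1 ord_max) //= big1 ?addr0; last first.
  move=> j jn; rewrite mxE A0 ?mul0r //= add0n addn1 ltnS ltn_neqAle -ltnS ltn_ord.
  by rewrite andbT; apply: contra jn => /eqP jn; apply/eqP/val_inj.
rewrite mxE /= Ad ?addn1 // /cofactor add0n.
set B := \det _.
have -> : B = detn (fun i j => A i.+1 j) n.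
  congr determinant; apply/matrixP=> i j; rewrite !mxE /= /bump /=.
  by rewrite leqNgt ltn_ord.
rewrite IHn; first last.
- by move=> i j ijn; apply: Ad; lia.
- by move=> i j ijn; apply: A0; lia.
by rewrite binS bin1 exprD exprS; ring.
Qed.

Lemma detn_row0 A n i :
  (i < n)%N -> (forall j, (j < n)%N -> A i j = 0) -> detn A n = 0.
Proof.
move=> lin A0; rewrite /detn (expand_det_row _ (Ordinal lin)) big1 // => j _.
by rewrite mxE A0 ?mul0r.
Qed.

End Determinants.

(** * Moment functionals and Hankel determinants *)

Section Moments.
Variable R : comNzRingType.
Implicit Types (mu : nat -> R) (q r : {poly R}).

Definition moment mu q : R := \sum_(i < size q) q`_i * mu i.

Lemma moment_widen mu q N :
  (size q <= N)%N -> moment mu q = \sum_(i < N) q`_i * mu i.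
Proof.
move=> qN; rewrite /moment (big_ord_widen _ (fun i => q`_i * mu i) qN).
rewrite [RHS](bigID (fun i : 'I_N => (i < size q)%N)) /=.
rewrite [X in _ + X]big1 ?addr0 // => i.
by rewrite -leqNgt => qi; rewrite nth_default ?mul0r.
Qed.

Lemma moment_is_linear mu : scalar (moment mu).
Proof.
move=> a q r; pose N := maxn (size q) (size r).
have qN : (size q <= N)%N by apply: leq_maxl.
have rN : (size r <= N)%N by apply: leq_maxr.
have aqrN : (size (a *: q + r)%R <= N)%N.
  by rewrite (leq_trans (size_polyD _ _)) // geq_max rN (leq_trans (size_scale_leq _ _)).
rewrite (moment_widen _ qN) (moment_widen _ rN) (moment_widen _ aqrN).
rewrite mulr_sumr -big_split; apply: eq_bigr => i _ /=.
by rewrite coefD coefZ mulrDl mulrA.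
Qed.

HB.instance Definition _ mu :=
  GRing.isLinear.Build R {poly R} R _ (moment mu) (moment_is_linear mu).

Lemma momentXn mu n : moment mu 'X^n = mu n.
Proof.
rewrite /moment size_polyXn big_ord_recr /= coefXn eqxx mul1r big1 ?add0r // => i _.
by rewrite coefXn ltn_eqF ?mul0r.
Qed.

Lemma momentXM mu q : moment mu ('X * q) = moment (fun i => mu i.+1) q.
Proof.
have sXq : (size ('X * q)%R <= (size q).+1)%N.
  by rewrite (leq_trans (size_polyMleq _ _)) // size_polyX.
rewrite (moment_widen _ sXq) big_ord_recl coefXM mul0r add0r.
by apply: eq_bigr => i _; rewrite coefXM.
Qed.

Lemma momentCM mu a q : moment mu (a%:P * q) = a * moment mu q.
Proof. by rewrite mul_polyC linearZ. Qed.

(** The coefficient matrix [P] of the family [q] is unitriangular, and the Gram matrix is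
    [P H P^T]. *)
Lemma detn_hankel mu (q : nat -> {poly R}) n :
  (forall i, q i \is monic) -> (forall i, size (q i) = i.+1) ->
  detn (fun i j => mu (i + j)%N) n = detn (fun i j => moment mu (q i * q j)) n.
Proof.
move=> q_monic sq; pose P : 'M[R]_n := \matrix_(i < n, j < n) (q i)`_j.
have detP : \det P = 1.
  rewrite det_trig; last first.
    by apply/is_trig_mxP=> i j ij; rewrite mxE nth_default ?sq.
  rewrite big1 // => i _; rewrite mxE; have /monicP := q_monic i.
  by rewrite /lead_coef sq.
pose H : 'M[R]_n := \matrix_(i < n, j < n) mu (i + j)%N.
have qE (i : 'I_n) : q i = \sum_(a < n) (q i)`_a *: 'X^a.
  rewrite -poly_def; apply/polyP=> a; rewrite coef_poly; case: ltnP => // na.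
  by rewrite nth_default // sq (leq_trans (ltn_ord i)).
suff -> : detn (fun i j => moment mu (q i * q j)) n = \det (P *m H *m P^T).
  by rewrite !det_mulmx det_tr detP mul1r mulr1.
congr determinant; apply/matrixP=> i j; rewrite !mxE [in LHS](qE i) [in LHS](qE j).
rewrite mulr_sumr raddf_sum; apply: eq_bigr => b _ /=.
rewrite !mxE -scalerAr linearZ /= mulrC; congr (_ * _).
rewrite mulr_suml raddf_sum; apply: eq_bigr => a _ /=.
by rewrite -scalerAl linearZ /= -exprD momentXn !mxE.
Qed.

End Moments.

(** * Path sums as moments, and Chebyshev-like polynomials *)

Section Recurrence.
Variables (R : comNzRingType) (c p : R).
Implicit Types (q r : {poly R}).

(** Splitting on the first step; the missing down-step at [k = 0] keeps paths nonnegative. *)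
Fixpoint walk_sum n k : R :=
  if n is n'.+1 then
    walk_sum n' k.+1 + c * walk_sum n' k
      + (if k is k'.+1 then p * walk_sum n' k' else 0)
  else 1.

Local Notation L k := (moment (walk_sum^~ k)).

(* Indices are shifted by one so that [cheb n] has size [n]. *)
Fixpoint cheb n : {poly R} :=
  if n is n'.+1 then
    if n' is n''.+1 then ('X - c%:P) * cheb n' - p%:P * cheb n'' else 1
  else 0.

Lemma cheb0 : cheb 0 = 0.
Proof. by []. Qed.

Lemma cheb1 : cheb 1 = 1.
Proof. by []. Qed.

Lemma chebSS n : cheb n.+2 = ('X - c%:P) * cheb n.+1 - p%:P * cheb n.
Proof. by []. Qed.

Arguments cheb : simpl never.

Lemma walk_moment1 k : L k 1 = 1.
Proof. by rewrite -[1]/('X^0) momentXn. Qed.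

Lemma walk_momentXM k q :
  L k ('X * q) = L k.+1 q + c * L k q + (if k is k'.+1 then p * L k' q else 0).
Proof.
rewrite momentXM /moment /=; case: k => [|k]; rewrite ?addr0 !mulr_sumr -!big_split /=;
  by apply: eq_bigr => i _; ring.
Qed.

(** Solved for [L k.+1 q], [walk_momentXM] is the recurrence of [cheb]. *)
Lemma walk_moment_cheb k q : L k q = L 0 (cheb k.+1 * q).
Proof.
suff [] : L k q = L 0 (cheb k.+1 * q) /\ L k.+1 q = L 0 (cheb k.+2 * q) by [].
elim: k q => [|k IHk] q.
  split; first by rewrite mul1r.
  rewrite chebSS cheb0 cheb1 mulr0 subr0 mulr1 mulrBl raddfB /= walk_momentXM momentCM /=; ring.
(* The instance at ['X * q] absorbs the factor ['X] of the recurrence. *)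
have [IH1 IH2] := (IHk q, IHk ('X * q)).
split; first by case: IH1.
case: IH1 IH2 => Ek Ek1 [_ EkX].
rewrite chebSS mulrBl raddfB /= -[p%:P * _ * q]mulrA momentCM -Ek mulrBl mulrBl raddfB /=.
rewrite -[c%:P * _ * q]mulrA momentCM -Ek1 -mulrA mulrCA -EkX walk_momentXM; ring.
Qed.

Lemma walk_moment0_cheb k : L 0 (cheb k.+1) = 1.
Proof. by rewrite -[cheb _]mulr1 -walk_moment_cheb walk_moment1. Qed.

(** An addition formula: both sides obey the same second-order recurrence in [m], so the induction
    carries two consecutive indices. *)
Lemma chebD m n :
  cheb (m + n).+1 = cheb m.+1 * cheb n.+1 - p%:P * cheb m * cheb n.
Proof.
suff [] : cheb (m + n).+1 = cheb m.+1 * cheb n.+1 - p%:P * cheb m * cheb n /\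
  cheb (m.+1 + n).+1 = cheb m.+2 * cheb n.+1 - p%:P * cheb m.+1 * cheb n by [].
elim: m => [|m [IH1 IH2]]; last first.
  by split=> //; rewrite 2!addSn chebSS -addSn IH2 IH1 (chebSS m.+1) (chebSS m); ring.
by rewrite add0n addSn add0n !chebSS cheb1 cheb0; split; ring.
Qed.

Lemma cheb_monic_size n : cheb n.+1 \is monic /\ size (cheb n.+1) = n.+1.
Proof.
suff [] : (cheb n.+1 \is monic /\ size (cheb n.+1) = n.+1) /\ (size (cheb n) <= n)%N by [].
elim: n => [|n [[IHm IHs] IHn]]; first by rewrite monic1 size_poly1 size_poly0.
split; last by rewrite IHs.
have s1 : size (('X - c%:P) * cheb n.+1) = n.+2.
  by rewrite size_monicM ?monicXsubC ?monic_neq0 // size_XsubC IHs.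
have s2 : (size (- (p%:P * cheb n))%R < size (('X - c%:P) * cheb n.+1)%R)%N.
  rewrite s1 size_polyN mul_polyC (leq_ltn_trans (size_scale_leq _ _)) //.
  by rewrite ltnS (leq_trans IHn).
rewrite chebSS size_polyDl // s1; split=> //.
by rewrite monicE lead_coefDl // -monicE monicMl ?monicXsubC.
Qed.

Lemma cheb_monic n : cheb n.+1 \is monic.
Proof. by case: (cheb_monic_size n). Qed.

Lemma size_cheb n : size (cheb n) = n.
Proof. by case: n => [|n]; [rewrite size_poly0 | case: (cheb_monic_size n)]. Qed.

(** [c + 1 + p] is the value of ['X] at which constant sequences satisfy the recurrence of
    [cheb]. *)
Definition zed : {poly R} := 'X - (c + 1 + p)%:P.

(** The recurrence trades each factor ['X] for a shift of the [cheb] index by at most one. A nonzero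
    value needs [m] downward shifts, each giving a factor [p], to reach the base value [- p]. *)
Lemma walk_moment_zed_chebXn j m :
  (j <= m)%N -> L 0 (zed * cheb m.+1 * 'X^j) = if j == m then - p ^+ m.+1 else 0.
Proof.
have zedE : zed = ('X - c%:P) - 1 - p%:P by rewrite /zed !polyCD; ring.
elim: j m => [|j IHj] [|m] //.
(* With no down-step from height [0], the value is [1 + c - (c + 1 + p) = - p]. *)
- move=> _; rewrite mulr1 mulr1 -[zed]mulr1 /zed mulrBl raddfB /= momentCM.
  by rewrite walk_momentXM addr0 !walk_moment1 expr1; ring.
- move=> _; rewrite mulr1 zedE.
  (* Each difference of consecutive terms has moment [1 - 1 = 0]. *)
  have -> : ('X - c%:P - 1 - p%:P) * cheb m.+2 =
     cheb m.+3 - cheb m.+2 + p%:P * (cheb m.+1 - cheb m.+2) by rewrite (chebSS m.+1); ring.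
  rewrite raddfD /= momentCM raddfB /= !walk_moment0_cheb raddfB /= !walk_moment0_cheb.
  by rewrite !subrr mulr0 addr0.
rewrite ltnS => jm.
have -> : zed * cheb m.+2 * 'X^(j.+1) = zed * cheb m.+3 * 'X^j
   + c%:P * (zed * cheb m.+2 * 'X^j) + p%:P * (zed * cheb m.+1 * 'X^j).
  by rewrite exprS (chebSS m.+1); ring.
have [jm1 jm2] : (j < m.+1)%N /\ (j < m.+2)%N by lia.
rewrite !raddfD /= !momentCM (IHj _ (ltnW jm2)) (IHj _ (ltnW jm1)) (IHj _ jm) eqSS.
rewrite (ltn_eqF jm1) (ltn_eqF jm2) mulr0 addr0 add0r.
by have [_|_] := eqVneq; rewrite ?mulr0 // [in RHS]exprS mulrN.
Qed.

Lemma walk_moment_zed_cheb m r :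
  (size r <= m.+1)%N -> L 0 (zed * cheb m.+1 * r) = - p ^+ m.+1 * r`_m.
Proof.
move=> sr; have rE : r = \sum_(j < m.+1) r`_j *: 'X^j.
  rewrite -poly_def; apply/polyP=> j; rewrite coef_poly.
  by case: ltnP => // mj; rewrite nth_default // (leq_trans sr).
rewrite [in LHS]rE mulr_sumr raddf_sum big_ord_recr /= -scalerAr linearZ /=.
rewrite walk_moment_zed_chebXn // eqxx big1 ?add0r => [|j _]; last first.
  by rewrite -scalerAr linearZ /= walk_moment_zed_chebXn 1?ltnW // ltn_eqF ?mulr0.
by rewrite mulrC.
Qed.


(** * The basis adapted to blocks of size [Q] *)

Variable k : nat.
Local Notation Q := k.+1.

(* The recursion divides [cheb (Q * a)] by [cheb Q] without leaving the ring. *)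
Fixpoint cheb_quo a : {poly R} :=
  if a is a'.+1 then cheb (Q * a').+1 - p%:P * cheb k * cheb_quo a' else 0.

(** In [chebD] at [k] and [Q * a], the second term contains [cheb (Q * a)], so [cheb Q] factors out
    of both. *)
Lemma cheb_quoM a : cheb Q * cheb_quo a = cheb (Q * a).
Proof.
elim: a => [|a IHa]; first by rewrite muln0 mulr0.
by rewrite mulnS addSn chebD -IHa [cheb_quo a.+1]/=; ring.
Qed.

Lemma cheb_quo_monic_size a :
  cheb_quo a.+1 \is monic /\ size (cheb_quo a.+1) = (Q * a).+1.
Proof.
elim: a => [|a [IHm IHs]].
  by rewrite muln0 /= mulr0 subr0 muln0 monic1 size_poly1.
have s2 : (size (- (p%:P * cheb k * cheb_quo a.+1))%R < size (cheb (Q * a.+1).+1))%N.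
  rewrite size_cheb size_polyN -mulrA mul_polyC (leq_ltn_trans (size_scale_leq _ _)) //.
  rewrite (leq_ltn_trans (size_polyMleq _ _)) // size_cheb IHs mulnS; lia.
rewrite [cheb_quo a.+2]/= -/(cheb_quo a.+1) size_polyDl // size_cheb; split=> //.
by rewrite monicE lead_coefDl // -monicE cheb_monic.
Qed.

Lemma cheb_quo_monic a : cheb_quo a.+1 \is monic.
Proof. by case: (cheb_quo_monic_size a). Qed.

Lemma size_cheb_quo a : size (cheb_quo a.+1) = (Q * a).+1.
Proof. by case: (cheb_quo_monic_size a). Qed.

Definition ortho i : {poly R} :=
  if (i %% Q)%N is s.+1 then zed * cheb_quo (i %/ Q).+1 * cheb s.+1
  else cheb_quo (i %/ Q).+1 - cheb_quo (i %/ Q).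

Lemma ortho_mul b : ortho (Q * b) = cheb_quo b.+1 - cheb_quo b.
Proof. by rewrite /ortho mulnC modnMl mulnK. Qed.

Lemma ortho_mulS b s :
  (s < k)%N -> ortho (Q * b + s.+1) = zed * cheb_quo b.+1 * cheb s.+1.
Proof.
move=> sk; rewrite /ortho mulnC modnMDl modn_small ?ltnS // divnMDl //.
by rewrite divn_small ?addn0 ?ltnS.
Qed.

Variant residue_spec : nat -> Prop :=
| ResidueZero b : residue_spec (Q * b)
| ResidueSucc b s of (s < k)%N : residue_spec (Q * b + s.+1).

Lemma residueP i : residue_spec i.
Proof.
rewrite (divn_eq i Q) mulnC; case E : (i %% Q)%N => [|s]; first by rewrite addn0; constructor.
by constructor; rewrite -ltnS -E ltn_pmod.
Qed.

Lemma ortho_monic_size i : ortho i \is monic /\ size (ortho i) = i.+1.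
Proof.
case: (residueP i) => [b|b s sk].
  have s2 : (size (- cheb_quo b)%R < size (cheb_quo b.+1))%N.
    rewrite size_polyN size_cheb_quo; case: b => [|b]; first by rewrite size_poly0.
    rewrite size_cheb_quo mulnS; lia.
  rewrite ortho_mul size_polyDl // size_cheb_quo; split=> //.
  by rewrite monicE lead_coefDl // -monicE cheb_quo_monic.
have zm : zed * cheb_quo b.+1 \is monic by rewrite monicMl ?monicXsubC ?cheb_quo_monic.
rewrite ortho_mulS // monicMl ?cheb_monic //; split=> //.
rewrite size_monicM ?monic_neq0 ?cheb_monic //.
rewrite size_monicM ?monicXsubC ?monic_neq0 ?cheb_quo_monic //.
rewrite size_XsubC size_cheb size_cheb_quo; lia.
Qed.

Lemma ortho_monic i : ortho i \is monic.
Proof. by case: (ortho_monic_size i). Qed.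

Lemma size_ortho i : size (ortho i) = i.+1.
Proof. by case: (ortho_monic_size i). Qed.

(** Multiplying by [cheb Q] gives [cheb (Q * b.+1) - cheb (Q * b)], which [walk_moment_zed_cheb]
    evaluates on multiples of [zed]. *)
Lemma walk_moment_quo_diff b r :
  (size r <= (Q * b).+1)%N ->
  L k ((cheb_quo b.+1 - cheb_quo b) * r) = p ^+ (Q * b) * r`_(Q * b).
Proof.
rewrite walk_moment_cheb mulrA mulrBr !cheb_quoM; case: b => [|b] sr.
  (* For [b = 0], [r] is constant and [cheb 0 = 0], so nothing cancels. *)
  rewrite muln0 in sr *; rewrite (size1_polyC sr) /= subr0 muln1 mulrC momentCM.
  by rewrite walk_moment0_cheb mulr1 mul1r coefC.
(* Write [r = r' * zed + r(w)]: the constant contributes [1 - 1 = 0]. *)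
pose w := c + 1 + p.
have : root (r - r.[w]%:P) w by rewrite rootE !hornerE subrr.
case/factor_theorem => r' /eqP; rewrite subr_eq -/zed => /eqP rE.
have sr' : (size r' <= Q * b.+1)%N.
  have [->|r'0] := eqVneq r' 0; first by rewrite size_poly0.
  have <- : (size (r' * zed)%R).-1 = size r'.
    by rewrite size_Mmonic ?monicXsubC // size_XsubC addn2.
  have -> : r' * zed = r - r.[w]%:P by rewrite {1}rE addrK.
  rewrite -subn1 leq_subLR add1n (leq_trans (size_polyD _ _)) // geq_max sr size_polyN.
  by rewrite (leq_trans (size_polyC_leq1 _)).
have rn : r`_(Q * b.+1) = r'`_(k + Q * b).
  rewrite {1}rE coefD coefC mulnS addSn addr0 mulrBr coefB coefMC coefMX /=.
  by rewrite [r'`_(_).+1]nth_default ?mul0r ?subr0 // -addSn -mulnS.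
rewrite rn {1}rE mulrDr raddfD /= [_ * _%:P]mulrC momentCM.
have -> : (cheb (Q * b.+2) - cheb (Q * b.+1)) * (r' * zed)
   = zed * cheb (Q * b.+2) * r' - zed * cheb (Q * b.+1) * r' by ring.
have QS a : (Q * a.+1 = (k + Q * a).+1)%N by rewrite mulnS addSn.
rewrite (QS b.+1) (QS b) in sr' *.
rewrite !raddfB /= !walk_moment0_cheb subrr mulr0 addr0.
rewrite !walk_moment_zed_cheb //; last by rewrite (leq_trans sr') //; lia.
(* [r'] is too short for the term of larger index; the other reads its top coefficient. *)
rewrite [r'`_(k + _.+1)]nth_default; last by rewrite (leq_trans sr') //; lia.
by rewrite mulr0 add0r mulNr opprK.
Qed.

Lemma walk_moment_zed_quo b s r :
  (size (cheb s.+1 * r)%R <= (Q * b + k).+1)%N ->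
  L k (zed * cheb_quo b.+1 * cheb s.+1 * r)
    = - p ^+ (Q * b.+1) * (cheb s.+1 * r)`_(Q * b + k).
Proof.
move=> sr; have -> : zed * cheb_quo b.+1 * cheb s.+1 * r
   = cheb_quo b.+1 * (zed * (cheb s.+1 * r)) by ring.
rewrite walk_moment_cheb mulrA cheb_quoM mulrA [cheb _ * zed]mulrC.
have -> : (Q * b.+1 = (Q * b + k).+1)%N by rewrite mulnS addSn addnC.
by rewrite walk_moment_zed_cheb.
Qed.

(** * The Gram matrix and its blocks *)

Definition gram i j := L k (ortho i * ortho j).

Lemma gramC i j : gram i j = gram j i.
Proof. by rewrite /gram mulrC. Qed.

Lemma gram_diag b : gram (Q * b) (Q * b) = p ^+ (Q * b).
Proof.
rewrite /gram {1}ortho_mul walk_moment_quo_diff ?size_ortho //.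
by have /monicP := ortho_monic (Q * b); rewrite /lead_coef size_ortho /= => ->; rewrite mulr1.
Qed.

Lemma size_cheb_ortho s j : size (cheb s.+1 * ortho j) = (s + j).+1.
Proof.
by rewrite size_monicM ?cheb_monic ?monic_neq0 ?ortho_monic // size_cheb size_ortho addnS.
Qed.

(** [cheb s.+1 * ortho j] is monic of degree [s + j], and the pairing sees only its coefficient in
    degree [Q * b + k]. *)
Lemma gram_zero b s j :
  (s < k)%N -> (s + j < Q * b + k)%N -> gram (Q * b + s.+1) j = 0.
Proof.
move=> sk sj; rewrite /gram ortho_mulS // walk_moment_zed_quo ?size_cheb_ortho; last first.
  by rewrite ltnS ltnW.
by rewrite nth_default ?size_cheb_ortho // mulr0.
Qed.

Lemma gram_antidiag b s j :
  (s < k)%N -> (s + j = Q * b + k)%N -> gram (Q * b + s.+1) j = - p ^+ (Q * b.+1).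
Proof.
move=> sk sj; rewrite /gram ortho_mulS // walk_moment_zed_quo ?size_cheb_ortho ?sj //.
have /monicP : cheb s.+1 * ortho j \is monic by rewrite monicMl ?cheb_monic ?ortho_monic.
by rewrite /lead_coef size_cheb_ortho sj /= => ->; rewrite mulr1.
Qed.

(** The bound admits the first index of the block of [j], so the matrix can be cut both before and
    after each block of size one. *)
Lemma gram_block i j : (i < j)%N -> (i <= Q * (j %/ Q))%N -> gram i j = 0.
Proof.
rewrite gramC; case: (residueP j) => [b|b s sk] ij iQ.
  rewrite /gram ortho_mul walk_moment_quo_diff ?size_ortho //; last by rewrite ltnW.
  by rewrite nth_default ?size_ortho ?mulr0.
apply: gram_zero => //; move: iQ.
by rewrite [(Q * b)%N]mulnC divnMDl // divn_small ?ltnS // addn0; lia.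
Qed.

Lemma detn_gram b :
  detn gram (Q * b) = (-1) ^+ (b * 'C(Q, 2)) * p ^+ (Q ^ 2 * 'C(b.+1, 2) - Q * b)
  /\ detn gram (Q * b).+1 = (-1) ^+ (b * 'C(Q, 2)) * p ^+ (Q ^ 2 * 'C(b.+1, 2)).
Proof.
have Qdiv m j : (Q * m <= j)%N -> (Q * m <= Q * (j %/ Q))%N.
  by move=> mj; rewrite leq_mul2l leq_divRL // mulnC mj.
have step1 m : detn gram (Q * m).+1 = detn gram (Q * m) * p ^+ (Q * m).
  rewrite -addn1 detn_lower_block.
    by rewrite {2}/detn det_mx11 mxE !addn0 gram_diag.
  move=> i j im mj; apply: gram_block; first exact: leq_trans im mj.
  by rewrite (leq_trans (ltnW im)) ?Qdiv.
(* The [k] indices after [Q * m] form an antitriangular block. *)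
have step2 m : detn gram (Q * m.+1)
    = detn gram (Q * m).+1 * ((-1) ^+ 'C(k, 2) * (- p ^+ (Q * m.+1)) ^+ k).
  have QS : (Q * m.+1 = (Q * m).+1 + k)%N by rewrite mulnS addnC addnS addSn.
  rewrite [in LHS]QS detn_lower_block.
    congr (_ * _); apply: detn_antitriangular => i j ijk.
      by rewrite addSnnS gram_zero //; lia.
    by rewrite addSnnS gram_antidiag //; lia.
  move=> i j im mj; apply: gram_block; first exact: leq_trans im mj.
  by rewrite ltnS in im; rewrite (leq_trans im) ?Qdiv // ltnW.
(* The final summand [Q * m.+1] makes the truncated subtraction exact. *)
have E m : (Q ^ 2 * 'C(m.+2, 2) = Q ^ 2 * 'C(m.+1, 2) + Q * m.+1 * k + Q * m.+1)%N.
  by rewrite [in LHS]binS bin1 mulnDr -mulnn -!mulnA; nia.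
elim: b => [|b [IH1 IH2]].
  by rewrite step1 !muln0 /detn det_mx00 sub0n mul0n expr0 mulr1.
have IH3 : detn gram (Q * b.+1)
   = (-1) ^+ (b.+1 * 'C(Q, 2)) * p ^+ (Q ^ 2 * 'C(b.+2, 2) - Q * b.+1).
  rewrite step2 IH2 E addnK [(- p ^+ _) ^+ k]exprNn -exprM (binS k 1) bin1 mulSn !exprD; ring.
split=> //; rewrite step1 IH3 E addnK -mulrA -exprD //.
Qed.

Lemma detn_gram_eq0 n : (n %% Q != 0)%N -> (n %% Q != 1)%N -> detn gram n = 0.
Proof.
rewrite {3}(divn_eq n Q) mulnC; have := ltn_pmod n (ltn0Sn k).
move: (n %% Q)%N (n %/ Q)%N => [|[|s]] // b sk _ _.
(* The truncation cuts an antitriangular block: its first row vanishes before column [Q * b + k],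
   and [n <= Q * b + k]. *)
apply: (@detn_row0 _ _ _ (Q * b + 1)); first by rewrite ltn_add2l.
move=> j jn; apply: gram_zero; lia.
Qed.

End Recurrence.

(** * From lattice paths to [walk_sum] *)

Section Paths.
Variables (R : comNzRingType) (x y : R).

(** An integer start keeps the down-step from [0] meaningful; the end point is free. *)
Definition nonneg_path n (h : int) (p : n.-tuple 'I_3) :=
  [forall i : 'I_n.+1, 0 <= h + \sum_(j < n | (j < i)%N) step_dy (tnth p j)].

Definition nonneg_sum n (h : int) : R :=
  \sum_(p : n.-tuple 'I_3 | nonneg_path h p) path_w x y p.

Lemma nonneg_path_cons n h s (p : n.-tuple 'I_3) :
  nonneg_path h (cons_tuple s p) = (0 <= h) && nonneg_path (h + step_dy s) p.
Proof.
have prefixE (i : nat) :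
    h + \sum_(j < n.+1 | (j < i.+1)%N) step_dy (tnth (cons_tuple s p) j)
    = h + step_dy s + \sum_(j < n | (j < i)%N) step_dy (tnth p j).
  rewrite big_mkcond big_ord_recl tnth0 ltn0Sn addrA; congr (_ + _).
  by rewrite [RHS]big_mkcond; apply: eq_bigr => j _; rewrite tnthS.
apply/forallP/andP => [pos|[h0 /forallP pos] i].
  split; first by have := pos ord0; rewrite big_pred0 ?addr0.
  by apply/forallP=> i; have := pos (lift ord0 i); rewrite prefixE.
case: (unliftP ord0 i) => [j|] ->; first by rewrite prefixE.
by rewrite big_pred0 ?addr0.
Qed.

Lemma nonneg_sumS n h :
  nonneg_sum n.+1 h =
    if 0 <= h then \sum_(s < 3) step_w x y s * nonneg_sum n (h + step_dy s) else 0.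
Proof.
rewrite /nonneg_sum.
rewrite (reindex (fun sp : 'I_3 * n.-tuple 'I_3 => cons_tuple sp.1 sp.2)) /=; last first.
  exists (fun q => (thead q, [tuple of behead q])) => [[s p] _|q _] /=.
    by congr (_, _); apply: val_inj.
  by rewrite [in RHS](tuple_eta q); apply: val_inj.
rewrite (eq_bigl (fun sp => (0 <= h) && nonneg_path (h + step_dy sp.1) sp.2)); last first.
  by move=> sp; rewrite nonneg_path_cons.
case: ifP => h0; last by rewrite big_pred0.
rewrite -(pair_big_dep xpredT (fun s p => nonneg_path (h + step_dy s) p)
  (fun s p => path_w x y (cons_tuple s p))) /=.
apply: eq_bigr => s _; rewrite mulr_sumr; apply: eq_bigr => p _.
by rewrite /path_w big_ord_recl; congr (_ * _); apply: eq_bigr => j _; rewrite tnthS.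
Qed.

Lemma nonneg_sum_lt0 n h : h < 0 -> nonneg_sum n h = 0.
Proof.
move=> h0; rewrite /nonneg_sum big_pred0 // => p; apply/negP => /forallP /(_ ord0).
by rewrite big_pred0 // addr0 leNgt h0.
Qed.

Lemma nonneg_sum_walk n k : nonneg_sum n k%:Z = walk_sum (x + y) (x * y) n k.
Proof.
elim: n k => [|n IHn] k.
  rewrite /nonneg_sum (big_pred1 [tuple]) /path_w ?big_ord0 // => p.
  rewrite (tuple0 p) [RHS]eq_refl; apply/forallP => i.
  by rewrite big_ord0 addr0.
rewrite nonneg_sumS lez_nat leq0n !big_ord_recl big_ord0.
have -> : step_dy (lift ord0 (lift ord0 ord0)) = 1 by [].
have -> : step_dy (lift ord0 ord0) = 0 by [].
have -> : step_dy ord0 = -1 by [].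
rewrite !addr0 -PoszD addn1 !IHn; case: k => [|k].
  (* The down-step from [0] leads to [-1], where no path counts. *)
  rewrite nonneg_sum_lt0 // /step_w /=; ring.
have -> : k.+1%:Z + -1 = k%:Z by lia.
rewrite IHn /step_w /=; ring.
Qed.

(** Each step rises by at most one, so the range of [l] in [Pplus_sum] covers every end point. *)
Lemma height_le n k (p : n.-tuple 'I_3) i : height k p i <= (n + k)%:Z.
Proof.
rewrite /height addnC PoszD lerD2l.
have -> : n%:Z = \sum_(j < n) 1 by rewrite sumr_const card_ord natz.
rewrite big_mkcond ler_sum // => j _; case: ifP => // _.
by rewrite /step_dy; case: (tnth p j) => s /=; lia.
Qed.

(** Each nonnegative path has exactly one end height, so exchanging the sums removes [l]. *)
Lemma Pplus_sum_walk n k : Pplus_sum x y n k = walk_sum (x + y) (x * y) n k.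
Proof.
rewrite -nonneg_sum_walk /Pplus_sum /Pplus /nonneg_sum.
rewrite (exchange_big_dep (@nonneg_path n k%:Z)) /=; last by move=> l p _ /andP[].
apply: eq_bigr => p pos; have := forallP pos ord_max; rewrite -/(height k p n) => h0.
have hle := height_le k p n.
have ltl : (`|height k p n| < (n + k).+1)%N by lia.
rewrite (big_pred1 (Ordinal ltl)) // => l /=.
rewrite [X in _ && X]pos andbT -val_eqE /=; lia.
Qed.

End Paths.

Theorem theorem3 (R : comNzRingType) (x y : R) (n k : nat) :
  (0 < n)%N ->
  let D := \det (\matrix_(i < n, j < n) Pplus_sum x y (i + j) k) in
  let n1 := (n %/ k.+1)%N in
  [/\ (n %% k.+1 = 0)%N ->
        D = (-1) ^+ (n1 * 'C(k.+1, 2)) * (x * y) ^+ (k.+1 ^ 2 * 'C(n1.+1, 2) - n),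
      (0 < k)%N -> (n %% k.+1 = 1)%N ->
        D = (-1) ^+ (n1 * 'C(k.+1, 2)) * (x * y) ^+ (k.+1 ^ 2 * 'C(n1.+1, 2)) &
      (n %% k.+1 != 0)%N -> (n %% k.+1 != 1)%N -> D = 0].
Proof.
move=> _ D n1.
(* The monic family [ortho] replaces the monomials. *)
have -> : D = detn (gram (x + y) (x * y) k) n.
  rewrite -(detn_hankel _ _ (@ortho_monic _ _ _ k) (@size_ortho _ _ _ k)).
  by congr determinant; apply/matrixP=> i j; rewrite !mxE Pplus_sum_walk.
have nE := divn_eq n k.+1; rewrite -/n1 mulnC in nE.
have [D0 D1] := detn_gram (x + y) (x * y) k n1.
split=> [n0|_ n0|]; last exact: detn_gram_eq0.
  by rewrite n0 addn0 in nE; rewrite nE D0.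
by rewrite n0 addn1 in nE; rewrite nE D1.
Qed.
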